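(* Let $p\in[1,\infty]$ and let $(X,d,A)$ be a metric pair. Then $W_p[d,A]$ is the largest $p$-subadditive metric $\rho$ on $D(X,A)$ satisfying $i^*\rho=d_p$; that is, $W_p[d,A]$ is such a metric, and every such $\rho$ satisfies $\rho\le W_p[d,A]$ pointwise.
   Context: A metric on a set $X$ is a function $d:X\times X\to[0,\infty]$ satisfying $d(x,x)=0$, $d(x,y)=d(y,x)$ and $d(x,y)\le d(x,z)+d(z,y)$ (an extended pseudometric). A metric pair $(X,d,A)$ is a set $X$ with a metric $d$ and a nonempty subset $A\subset X$. Write $d(x,A)=d(A,x)=\inf_{a\in A}d(x,a)$. The $p$-norms $\|\cdot\|_p$ are the usual ones on finite tuples ($\max$ of absolute values for $p=\infty$), extended to entries in $[0,\infty]$. For a metric pair $(X,d,A)$ define $d_p:X\times X\to[0,\infty]$ by $d_p(x,y)=\min\big(d(x,y),\|(d(x,A),d(A,y))\|_p\big)$. $D(X)$ is the free commutative monoid on $X$ (finite formal sums of elements of $X$). $D(X,A):=D(X)/D(A)$ is the quotient monoid, where $\alpha\sim\beta$ iff $\alpha+\xi=\beta+\eta$ for some $\xi,\eta\in D(A)$; thus $D(X,A)\cong D(X\setminus A)$. The canonical inclusion $i:X\to D(X,A)$ sends $x$ to the class of the formal sum $x$ (so $i(A)=\{0\}$). For a metric $\rho$ on $D(X,A)$, the pullback is $i^*\rho(x,y):=\rho(i(x),i(y))$. A metric $\rho$ on a commutative monoid $M$ is $p$-subadditive if $\rho(a+b,a'+b')\le\|(\rho(a,a'),\rho(b,b'))\|_p$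 for all $a,b,a',b'\in M$. The $p$-Wasserstein distance $W_p[d,A]$ on $D(X,A)$ is $$W_p[d,A](x_1+\cdots+x_m,\,x_1'+\cdots+x_n')=\inf\big\|(d(x_k,x'_{\sigma(k)}))_{k=1}^{m+n}\big\|_p,$$ the infimum being over all $x_{m+1},\ldots,x_{m+n},x'_{n+1},\ldots,x'_{n+m}\in A$ and all permutations $\sigma\in\Sigma_{m+n}$. *)

(* Defs.v *)
From HB Require Import structures.
From mathcomp Require Import all_boot all_order all_algebra perm.
From mathcomp Require Import finmap multiset.
From mathcomp Require Import all_classical all_reals all_analysis.
From mathcomp Require Import zify.

Set Implicit Arguments.
Unset Strict Implicit.
Unset Printing Implicit Defensive.

Import Order.TTheory GRing.Theory Num.Theory.

Local Open Scope classical_set_scope.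
Local Open Scope ring_scope.
Local Open Scope ereal_scope.
Local Open Scope quotient_scope.

Section Metrics.
Context {R : realType}.
Implicit Types (p : \bar R).

Definition is_metric (T : Type) (d : T -> T -> \bar R) : Prop :=
  [/\ forall x y, 0 <= d x y,
      forall x, d x x = 0,
      forall x y, d x y = d y x
    & forall x y z, d x y <= d x z + d z y].

Definition is_metric_pair (T : Type) (d : T -> T -> \bar R) (A : set T) : Prop :=
  is_metric d /\ A !=set0.

Definition dist_set (T : Type) (d : T -> T -> \bar R) (A : set T) (x : T) : \bar R :=
  ereal_inf [set d x a | a in A].

(* Only used for [1 <= p]; the value at [p = -oo] is junk. *)
Definition pnorm p (s : seq (\bar R)) : \bar R :=
  match p with
  | r%:E => (\sum_(x <- s) `|x| `^ r) `^ r^-1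
  | +oo => \big[maxe/0]_(x <- s) `|x|
  | -oo => 0
  end.

Definition dist_p p (T : Type) (d : T -> T -> \bar R) (A : set T) (x y : T) : \bar R :=
  mine (d x y) (pnorm p [:: dist_set d A x; dist_set d A y]).

Definition p_subadditive p (M : nmodType) (rho : M -> M -> \bar R) : Prop :=
  forall a b a' b' : M,
    rho (a + b)%R (a' + b')%R <= pnorm p [:: rho a a'; rho b b'].

Definition pullback (T U : Type) (f : T -> U) (rho : U -> U -> \bar R)
  (x y : T) : \bar R := rho (f x) (f y).

End Metrics.

Section FormalSums.
Variable X : choiceType.

(* D(X): finite multisets, written additively. *)
Definition formal_sum : Type := {mset X}%mset.

HB.instance Definition _ := Choice.copy formal_sum {mset X}%mset.

Fact formal_sum_addA : associative (@msetD X : formal_sum -> _ -> formal_sum).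
Proof. exact: msetDA. Qed.
Fact formal_sum_addC : commutative (@msetD X : formal_sum -> _ -> formal_sum).
Proof. exact: msetDC. Qed.
Fact formal_sum_add0 :
  left_id (mset0 : formal_sum) (@msetD X : formal_sum -> _ -> formal_sum).
Proof. exact: mset0D. Qed.

HB.instance Definition _ := GRing.isNmodule.Build formal_sum
  formal_sum_addA formal_sum_addC formal_sum_add0.

Definition of_seq (s : seq X) : formal_sum := seq_mset s.
Definition terms (a : formal_sum) : seq X := enum_mset a.

Lemma perm_of_seq s : perm_eq (terms (of_seq s)) s.
Proof. exact: perm_eq_seq_mset. Qed.

Lemma of_seq_terms a : of_seq (terms a) = a.
Proof. exact: seq_mset_id. Qed.

Lemma of_seqP s t : reflect (of_seq s = of_seq t) (perm_eq s t).
Proof. exact: eq_seq_msetP. Qed.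

Lemma of_seq_cat s t : of_seq (s ++ t) = (of_seq s + of_seq t)%R.
Proof.
by apply/msetP => x; rewrite msetE2 !mset_seqE count_cat.
Qed.

Lemma terms_add (a b : formal_sum) :
  perm_eq (terms (a + b)%R) (terms a ++ terms b).
Proof. by apply/of_seqP; rewrite of_seq_cat !of_seq_terms. Qed.

Variable A : set X.

(* the submonoid D(A) of D(X) *)
Definition supported (a : formal_sum) : Prop := forall x, x \in terms a -> A x.

Lemma supported0 : supported 0%R.
Proof. by move=> x; rewrite /terms enum_mset0. Qed.

Lemma supportedD a b : supported a -> supported b -> supported (a + b)%R.
Proof.
move=> Aa Ab x; rewrite (perm_mem (terms_add a b)) mem_cat.
by case/orP => [/Aa|/Ab].
Qed.

Definition rel_mod (a b : formal_sum) : bool :=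
  `[< exists xi eta, [/\ supported xi, supported eta & a + xi = b + eta]%R >].

Fact rel_mod_refl : reflexive rel_mod.
Proof. by move=> a; apply/asboolP; exists 0%R, 0%R; split=> //; exact: supported0. Qed.

Fact rel_mod_sym : symmetric rel_mod.
Proof.
by move=> a b; apply/asboolP/asboolP => -[xi [eta [Axi Aeta E]]]; exists eta, xi.
Qed.

Fact rel_mod_trans : transitive rel_mod.
Proof.
move=> b a c /asboolP[xi [eta [Axi Aeta E]]] /asboolP[xi' [eta' [Axi' Aeta' E']]].
apply/asboolP; exists (xi + xi')%R, (eta' + eta)%R; split; try exact: supportedD.
by rewrite addrA E addrAC E' addrA.
Qed.

Canonical rel_mod_equiv :=
  EquivRel rel_mod rel_mod_refl rel_mod_sym rel_mod_trans.

(* D(X, A) = D(X) / D(A) *)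
Definition relsum : Type := {eq_quot rel_mod}.

HB.instance Definition _ : EqQuotient formal_sum rel_mod relsum :=
  EqQuotient.on relsum.
HB.instance Definition _ := Choice.on relsum.

Lemma relsumP (a b : formal_sum) :
  (\pi_relsum a = \pi_relsum b) <->
  exists xi eta, [/\ supported xi, supported eta & a + xi = b + eta]%R.
Proof.
by split=> [/eqmodP/asboolP|E] //; apply/eqmodP/asboolP.
Qed.

Definition relsum_zero : relsum := \pi_relsum 0%R.
Definition relsum_add (a b : relsum) : relsum := \pi_relsum (repr a + repr b)%R.

Lemma pi_relsum_add (a b : formal_sum) :
  \pi_relsum (a + b)%R = relsum_add (\pi a) (\pi b).
Proof.
have /relsumP[xi [eta [Axi Aeta E]]] := esym (reprK (\pi_relsum a)).
have /relsumP[xi' [eta' [Axi' Aeta' E']]] := esym (reprK (\pi_relsum b)).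
apply/relsumP; exists (xi + xi')%R, (eta + eta')%R.
by split; [exact: supportedD..|rewrite addrACA E E' addrACA].
Qed.

Fact relsum_addA : associative relsum_add.
Proof.
move=> a b c; rewrite -[a]reprK -[b]reprK -[c]reprK.
by rewrite -!pi_relsum_add addrA.
Qed.
Fact relsum_addC : commutative relsum_add.
Proof. by move=> a b; rewrite /relsum_add addrC. Qed.
Fact relsum_add0 : left_id relsum_zero relsum_add.
Proof. by move=> a; rewrite -[a]reprK -pi_relsum_add add0r. Qed.

HB.instance Definition _ := GRing.isNmodule.Build relsum
  relsum_addA relsum_addC relsum_add0.

Lemma relsum_piD (a b : formal_sum) :
  \pi_relsum (a + b)%R = (\pi_relsum a + \pi_relsum b)%R.
Proof. exact: pi_relsum_add. Qed.

Definition relsum_incl (x : X) : relsum := \pi_relsum (of_seq [:: x]).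

Lemma sum_relsum_incl (s : seq X) : (\sum_(x <- s) relsum_incl x)%R = \pi_relsum (of_seq s).
Proof.
elim: s => [|x s IHs].
  by rewrite big_nil; congr (\pi_relsum _); rewrite -[LHS]of_seq_terms /terms enum_mset0.
by rewrite big_cons IHs -relsum_piD -of_seq_cat.
Qed.

End FormalSums.

Section Wasserstein.
Context {R : realType} {X : choiceType}.
Variables (p : \bar R) (d : X -> X -> \bar R) (A : set X).
Implicit Types (s t : seq X).

(* The costs over which the infimum is taken, for s = [:: x_1; ..; x_m] and
   t = [:: x'_1; ..; x'_n]: a lists x_(m+1), .., x_(m+n) and
   a' lists x'_(n+1), .., x'_(n+m). *)
Definition matching_costs s t : set (\bar R) :=
  [set c | exists (a : (size t).-tuple X) (a' : (size s).-tuple X)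
                  (sigma : 'S_(size s + size t)),
    [/\ forall x, x \in a -> A x, forall x, x \in a' -> A x &
      c = pnorm p [seq d (tnth (cat_tuple (in_tuple s) a) k)
             (tnth (cat_tuple (in_tuple t) a') (cast_ord (addnC _ _) (sigma k)))
           | k : 'I_(size s + size t)]]].

Definition wasserstein_seq s t : \bar R := ereal_inf (matching_costs s t).

(* Lifted to D(X, A) through representatives; [wassersteinE] shows that the
   choice of the representatives is irrelevant. *)
Definition wasserstein (a b : relsum A) : \bar R :=
  wasserstein_seq (terms (repr a)) (terms (repr b)).

Lemma pnormE_perm (u v : seq (\bar R)) : perm_eq u v -> pnorm p u = pnorm p v.
Proof. by move=> uv; case: p => [r||] //=; rewrite (perm_big _ uv). Qed.

Lemma poweR_mono (r : R) (x y : \bar R) :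
  (0 <= r)%R -> 0 <= x -> x <= y -> x `^ r <= y `^ r.
Proof.
move=> r0 x0 xy; apply: gt0_ler_poweR => //; rewrite in_itv /= leey andbT //.
exact: le_trans xy.
Qed.

Hypothesis p1 : 1 <= p.

Lemma pnorm_cons0 (u : seq (\bar R)) : pnorm p (0 :: u) = pnorm p u.
Proof.
move: p1; case: p => [r||] //= r1; rewrite big_cons abse0.
  rewrite poweR0r ?add0e //; move: r1; rewrite lee_fin => r1.
  by rewrite gt_eqF // (lt_le_trans ltr01).
by apply/max_idPr; elim/big_ind: _ => // x y x0 y0; rewrite le_max x0.
Qed.

Lemma pnorm_cat0 (u v : seq (\bar R)) :
  (forall x, x \in v -> x = 0) -> pnorm p (u ++ v) = pnorm p u.
Proof.
rewrite (pnormE_perm (permEl (perm_catC u v))).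
elim: v => //= x v IH v0; rewrite (v0 x) ?mem_head // pnorm_cons0.
by apply: IH => y yv; apply: v0; rewrite in_cons yv orbT.
Qed.

Lemma pnorm_cons_le x (u : seq (\bar R)) : pnorm p u <= pnorm p (x :: u).
Proof.
move: p1; case: p => [r||] //= r1; rewrite big_cons.
  have r0 : (0 <= r)%R by apply: le_trans ler01 _; rewrite -lee_fin.
  apply: poweR_mono; rewrite ?invr_ge0 //.
    by apply: sume_ge0 => y _; exact: poweR_ge0.
  by rewrite leeDr // poweR_ge0.
by rewrite le_max lexx orbT.
Qed.

Let cost (l : seq (X * X)) := pnorm p [seq d z.1 z.2 | z <- l].

Let loose s t : set (\bar R) :=
  [set c | exists (l : seq (X * X)) (a a' : seq X),
    [/\ forall x, x \in a -> A x, forall x, x \in a' -> A x,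
        perm_eq (unzip1 l) (s ++ a), perm_eq (unzip2 l) (t ++ a')
      & c = cost l]].

Hypothesis dA : is_metric_pair d A.

Let unzip1_sort (l : seq (X * X)) s :
  perm_eq (unzip1 l) s -> exists2 l', perm_eq l l' & unzip1 l' = s.
Proof.
elim: s l => [|x s IH] l ls.
  by exists [::] => //; move/perm_size: ls; rewrite size_map; case: l.
have: x \in unzip1 l by rewrite (perm_mem ls) mem_head.
case/mapP => z zl E; have lz := perm_to_rem zl.
have /IH[l' ll' <-] : perm_eq (unzip1 (rem z l)) s.
  rewrite -(perm_cons x) -(permPr ls) E -[_ :: _]/(unzip1 (z :: rem z l)).
  by rewrite perm_sym; apply: perm_map.
by exists (z :: l'); rewrite /= -?E // (permPl lz) perm_cons.
Qed.

Let tight_loose s t : matching_costs s t `<=` loose s t.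
Proof.
move=> c [a [a' [sg [Aa Aa' ->]]]].
set S := cat_tuple (in_tuple s) a; set T := cat_tuple (in_tuple t) a'.
exists [seq (tnth S k, tnth T (cast_ord (addnC _ _) (sg k)))
  | k : 'I_(size s + size t)], a, a'; split=> //.
- rewrite /unzip1 -map_comp -[s ++ a]/(tval S).
  by rewrite -(map_tnth_enum S) perm_refl.
- rewrite /unzip2 -map_comp -[t ++ a']/(tval T) -(map_tnth_enum T).
  rewrite [X in perm_eq X _](_ : _ =
    [seq tnth T i | i <- [seq cast_ord (addnC _ _) (sg k) | k : 'I_(size s + size t)]]).
  apply: perm_map; apply: uniq_perm; rewrite ?enum_uniq //.
    by rewrite map_inj_uniq ?enum_uniq // => x y /cast_ord_inj /perm_inj.
  move=> y; rewrite mem_enum; apply/mapP.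
  exists (perm_inv sg (cast_ord (addnC _ _) y)); first by rewrite mem_enum.
  by rewrite permKV; apply: val_inj.
  by rewrite -[RHS]map_comp.
- by rewrite /cost -[in RHS]map_comp.
Qed.

Let shrink s t (l : seq (X * X)) (a a' : seq X) :
  (forall x, x \in a -> A x) -> (forall x, x \in a' -> A x) ->
  perm_eq (unzip1 l) (s ++ a) -> perm_eq (unzip2 l) (t ++ a') ->
  (size t <= size a)%N ->
  exists l2 a2 a2',
    [/\ forall x, x \in a2 -> A x, forall x, x \in a2' -> A x,
      perm_eq (unzip1 l2) (s ++ a2), perm_eq (unzip2 l2) (t ++ a2')
      & size a2 = size t /\ cost l2 <= cost l].
Proof.
have [k ak] := ubnP (size a); elim: k l a a' ak => // k IH l a a'.
rewrite ltnS => ak Aa Aa' la la'; rewrite leq_eqVlt => /orP[/eqP ta|ta].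
  by exists l, a, a'.
have [l0 ll0 E] := unzip1_sort la.
have cl : cost l = cost l0 by apply: pnormE_perm; exact: perm_map.
have l0a' : perm_eq (unzip2 l0) (t ++ a').
  by apply: perm_trans la'; rewrite perm_sym; exact: perm_map.
pose l1 := take (size s) l0; pose r := drop (size s) l0.
have El0 : l0 = l1 ++ r by rewrite cat_take_drop.
have Es : unzip1 l1 = s by rewrite /unzip1 map_take -/(unzip1 l0) E take_size_cat.
have Er : unzip1 r = a by rewrite /unzip1 map_drop -/(unzip1 l0) E drop_size_cat.
have [z zr yt] : exists2 z, z \in r &
    (count_mem z.2 t < count_mem z.2 (unzip2 r))%N.
  apply: contrapT => H; move: ta; rewrite ltnNge => /negP; apply.
  rewrite -Er size_map -(size_map snd).
  have /count_subseqP[v /size_subseq vt /perm_size ->//] :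
      forall x, (count_mem x (unzip2 r) <= count_mem x t)%N.
  move=> x; rewrite leqNgt; apply/negP => xt; apply: H.
  have /mapP[z zr Ez] : x \in unzip2 r by rewrite -has_pred1 has_count; lia.
  by exists z; rewrite // -Ez.
have a'z : z.2 \in a'.
  have /seq.permP/(_ (pred1 z.2)) := l0a'.
  rewrite El0 /unzip2 map_cat !count_cat -has_pred1 has_count.
  by move: yt; rewrite /unzip2; lia.
pose l2 := l1 ++ rem z r.
have l0l2 : perm_eq l0 (z :: l2).
  rewrite El0 /l2 -cat_cons -cat1s perm_sym -catA perm_catCA perm_cat2l perm_sym.
  exact: perm_to_rem.
have cl2 : cost l2 <= cost l.
  rewrite cl (_ : cost l0 = cost (z :: l2)); first exact: pnorm_cons_le.
  by apply: pnormE_perm; exact: perm_map.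
have [||||||l3 [a3 [a3' [? ? ? ? [? H]]]]] :=
    IH l2 (unzip1 (rem z r)) (rem z.2 a').
- by move: ak; rewrite -Er !size_map size_rem //; case: (r) zr.
- by move=> x /mapP[y /mem_rem yr ->]; apply: Aa; rewrite -Er map_f.
- by move=> x /mem_rem /Aa'.
- by rewrite /l2 /unzip1 map_cat -/(unzip1 _) Es.
- rewrite -(perm_cons z.2) -[_ :: unzip2 _]/(unzip2 (z :: l2)).
  have /seq.permPl <- : perm_eq (unzip2 l0) (unzip2 (z :: l2)) by exact: perm_map.
  rewrite (permPl l0a') -cat1s perm_sym perm_catCA perm_cat2l perm_sym.
  exact: perm_to_rem.
- by move: ta; rewrite -Er !size_map size_rem //; case: (r) zr.
by exists l3, a3, a3'; split=> //; split=> //; apply: le_trans cl2.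
Qed.

Let tighten s t c : loose s t c -> exists2 c', c' <= c & matching_costs s t c'.
Proof.
move=> [l0 [b [b' [Ab Ab' lb lb' ->]]]].
have [a0 Aa0] : A !=set0 by case: dA.
have d0 : forall x, d x x = 0 by case: dA => -[].
have nA n x : x \in nseq n a0 -> A x by rewrite mem_nseq => /andP[_ /eqP ->].
have : exists l a a',
    [/\ forall x, x \in a -> A x, forall x, x \in a' -> A x,
      perm_eq (unzip1 l) (s ++ a), perm_eq (unzip2 l) (t ++ a')
      & size a = size t /\ cost l <= cost l0].
  pose n := nseq (size t) a0.
  have [|||||l [a [a' [? ? ? ? [? H]]]]] :=
     @shrink s t (l0 ++ nseq (size t) (a0, a0)) (b ++ n) (b' ++ n).
  - by move=> x; rewrite mem_cat => /orP[/Ab|/nA].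
  - by move=> x; rewrite mem_cat => /orP[/Ab'|/nA].
  - by rewrite /unzip1 map_cat map_nseq catA perm_cat2r.
  - by rewrite /unzip2 map_cat map_nseq catA perm_cat2r.
  - by rewrite size_cat size_nseq leq_addl.
  exists l, a, a'; split=> //; split=> //; apply: le_trans H _.
  rewrite /cost map_cat pnorm_cat0 // => x /mapP[z].
  by rewrite mem_nseq => /andP[_ /eqP ->] ->.
move=> [l1 [a [a' [Aa Aa' la1 la' [sa cl]]]]].
have [l ll1 Es] := unzip1_sort la1.
have la2 : perm_eq (unzip2 l) (t ++ a').
  by apply: perm_trans la'; rewrite perm_sym; exact: perm_map.
have sa' : size a' = size s.
  have := perm_size la2; rewrite size_map -(size_map fst) -/(unzip1 l) Es.
  by rewrite !size_cat sa addnC => /addnI.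
exists (cost l).
  by rewrite (_ : cost l = cost l1) //; apply: pnormE_perm; rewrite perm_map // perm_sym.
have /eqP sa1 := sa; have /eqP sa1' := sa'.
pose S := cat_tuple (in_tuple s) (Tuple sa1).
pose T := cat_tuple (in_tuple t) (Tuple sa1').
have : perm_eq (unzip2 l) (tcast (addnC _ _) T) by rewrite val_tcast.
case/tuple_permP => sg Esg.
exists (Tuple sa1), (Tuple sa1'), sg; split=> //.
rewrite /cost; congr (pnorm p _).
have {}Esg : unzip2 l = [seq tnth (tcast (addnC _ _) T) (sg i) |
  i : 'I_(size s + size t)] := Esg.
rewrite -[l in LHS]zip_unzip Es Esg -[s ++ a]/(tval S) -(map_tnth_enum S).
rewrite zip_map -map_comp; apply: eq_map => k /=.
by rewrite tcastE; congr (d _ (tnth _ _)); apply: val_inj.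
Qed.

Let wass_loose s t : wasserstein_seq s t = ereal_inf (loose s t).
Proof.
apply/eqP; rewrite eq_le; apply/andP; split.
  apply: le_ereal_inf_tmp => c /tighten[c' c'c m]; apply: le_trans c'c.
  exact: ereal_inf_lbound.
by apply: le_ereal_inf_tmp => c /tight_loose; exact: ereal_inf_lbound.
Qed.

Let loose_sub s t s' t' u u' v v' :
  (forall x, x \in u -> A x) -> (forall x, x \in u' -> A x) ->
  (forall x, x \in v -> A x) -> (forall x, x \in v' -> A x) ->
  perm_eq (s ++ u) (s' ++ u') -> perm_eq (t ++ v) (t' ++ v') ->
  loose s t `<=` loose s' t'.
Proof.
move=> Au Au' Av Av' /seq.permP su /seq.permP tv c [l [a [a' [Aa Aa' /seq.permP la /seq.permP la' ->]]]].
have d0 : forall x, d x x = 0 by case: dA => -[].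
exists (l ++ [seq (x, x) | x <- u ++ v]), (u' ++ a ++ v), (v' ++ a' ++ u); split.
- by move=> x; rewrite !mem_cat => /or3P[/Au'|/Aa|/Av].
- by move=> x; rewrite !mem_cat => /or3P[/Av'|/Aa'|/Au].
- apply/seq.permP => P; have := su P; have := la P.
  rewrite /unzip1 map_cat -map_comp (eq_map (g := id)) // map_id !count_cat; lia.
- apply/seq.permP => P; have := tv P; have := la' P.
  rewrite /unzip2 map_cat -map_comp (eq_map (g := id)) // map_id !count_cat; lia.
- rewrite /cost map_cat pnorm_cat0 // => x; rewrite -map_comp => /mapP[y _ ->].
  exact: d0.
Qed.

Let repr_perm s : exists u u',
  [/\ forall x, x \in u -> A x, forall x, x \in u' -> A x
    & perm_eq (terms (repr (\pi_(relsum A) (of_seq s))) ++ u) (s ++ u')].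
Proof.
have /relsumP[xi [eta [Axi Aeta E]]] := reprK (\pi_(relsum A) (of_seq s)).
exists (terms xi), (terms eta); split=> //.
rewrite -(permPl (terms_add _ _)) E (permPl (terms_add _ _)) perm_cat2r.
exact: perm_of_seq.
Qed.

Lemma wassersteinE s t :
  wasserstein (\sum_(x <- s) relsum_incl A x)%R (\sum_(y <- t) relsum_incl A y)%R
  = wasserstein_seq s t.
Proof.
rewrite !sum_relsum_incl /wasserstein !wass_loose; congr ereal_inf.
have [u [u' [Au Au' su]]] := repr_perm s.
have [v [v' [Av Av' tv]]] := repr_perm t.
by apply/seteqP; split; [apply: (loose_sub Au Au' Av Av') |
  apply: (loose_sub Au' Au Av' Av)]; rewrite // perm_sym.
Qed.

End Wasserstein.

Arguments wasserstein {R X} p d A a b.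

(* Main.v *)
Require Import Defs.
From HB Require Import structures.
From mathcomp Require Import all_boot all_order all_algebra perm.
From mathcomp Require Import finmap multiset.
From mathcomp Require Import all_classical all_reals all_analysis.
From mathcomp Require Import ring.

Import Order.TTheory GRing.Theory Num.Theory.

Local Open Scope classical_set_scope.
Local Open Scope ring_scope.
Local Open Scope ereal_scope.

(** The point is to forget the bookkeeping of the m + n padded terms.  Since
    [relsum_incl A] kills A, a matching between formal sums [a] and [b] is the
    same thing as a transport plan: a finite list of pairs whose first
    components sum to [a] and whose second components sum to [b] in D(X, A).
    Any plan can be used here, because the distance does not depend on the
    sequences that represent [a] and [b] ([wassersteinE]), so that one may
    compute it on the two components of the plan itself.  Hence
    [wasserstein p d A a b] is the infimum of the costs of the plans from [a]
    to [b] ([wasserstein_inf]).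

    In this form every claim comes from an operation on plans.
    - Symmetry swaps the components, and the plan of pairs (x, x) costs 0.
    - Two plans from [a] to [c] and from [c] to [b] have middle components that
      agree up to terms in A; after adding pairs (x, x), which are free, the
      two plans can be composed, and the triangle inequality for [d] together
      with Minkowski's inequality bounds the cost ([plan_glue]).
    - Concatenation of plans gives p-subadditivity, the p-norm of a
      concatenation being the p-norm of the two p-norms ([pnorm_cat]).
    - Between two generators, a matching either sends x to y or sends both
      to A; these are the two terms in the minimum defining [dist_p].
    - A p-subadditive metric rho with rho <= d on generators is at most the
      cost of each plan, by p-subadditivity along the list, hence at most the
      infimum ([wasserstein_largest]).

    All statements about p-norms are reduced to pairs of numbers by
    [pnorm_cons]; infima pass through the norm of a pair because Minkowski's
    inequality makes that norm 1-Lipschitz in each entry ([le_pnorm_infl]). *)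

(** * The p-norm of finite families of extended reals *)

Section PNorm.
Context {R : realType}.
Set Implicit Arguments.
Unset Strict Implicit.
Implicit Types (p : \bar R) (u v : seq (\bar R)).

(** Convexity of t |-> t^r, applied to x / a and y / b with weights
    a / (a + b) and b / (a + b): with a and b the norms of two vectors and x, y
    corresponding entries, summing over the entries yields Minkowski. *)
Lemma powR_addr_convex (r a b x y : R) :
  (1 <= r -> 0 < a -> 0 < b -> 0 <= x -> 0 <= y ->
  (x + y) `^ r <=
    (a + b) `^ r *
      (a / (a + b) * (x `^ r / a `^ r) + b / (a + b) * (y `^ r / b `^ r)))%R.
Proof.
move=> r1 a0 b0 x0 y0; have ab0 : (0 < a + b)%R by rewrite addr_gt0.
have t0 : (0 <= a / (a + b))%R by rewrite divr_ge0 // ltW.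
have t1 : (a / (a + b) <= 1)%R by rewrite ler_pdivrMr // mul1r lerDl ltW.
have tC : (1 - a / (a + b) = b / (a + b))%R.
  by rewrite -{1}(@divff _ (a + b)%R) ?gt_eqF // -mulrBl addrAC subrr add0r.
have := @convex_powR R r r1 (Itv01 t0 t1) (x / a)%R (y / b)%R.
rewrite !inE /= !in_itv /= !andbT !divr_ge0 ?(ltW a0) ?(ltW b0) // => /(_ isT isT).
rewrite convRE [X in (X `^ _ <= _)%R -> _]convRE /= /unstable.onem !tC => H.
have -> : (x + y = (a + b) * (a / (a + b) * (x / a) + b / (a + b) * (y / b)))%R.
  have a0' : a != 0%R by rewrite gt_eqF.
  have b0' : b != 0%R by rewrite gt_eqF.
  have ab0' : (a + b)%R != 0%R by rewrite gt_eqF.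
  by field; rewrite a0' b0' ab0'.
rewrite powRM ?(ltW ab0) //; last first.
  by rewrite addr_ge0 // !mulr_ge0 ?invr_ge0 // ltW.
rewrite ler_wpM2l ?powR_ge0 //; apply: (le_trans H).
have powRV c : (0 < c -> c^-1 `^ r = (c `^ r)^-1)%R.
  by move=> c0; rewrite -(powR_inv1 (ltW c0)) -powRrM mulN1r powRN.
by rewrite !powRM ?invr_ge0 ?(ltW a0) ?(ltW b0) // !powRV.
Qed.

Lemma powR_minkowski2 (r x x' y y' : R) :
  (1 <= r -> 0 <= x -> 0 <= x' -> 0 <= y -> 0 <= y' ->
  ((x + x') `^ r + (y + y') `^ r) `^ r^-1 <=
    (x `^ r + y `^ r) `^ r^-1 + (x' `^ r + y' `^ r) `^ r^-1)%R.
Proof.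
move=> r1 x0 x'0 y0 y'0; have r0 : (0 < r)%R := lt_le_trans ltr01 r1.
have sum0 (u v : R) : (0 <= u -> 0 <= v ->
    (u `^ r + v `^ r) `^ r^-1 = 0 -> u = 0 /\ v = 0)%R.
  move=> u0 v0 /powR_eq0_eq0 /eqP.
  by rewrite paddr_eq0 ?powR_ge0 // =>
    /andP[/eqP /powR_eq0_eq0 -> /eqP /powR_eq0_eq0 ->].
set a := ((x `^ r + y `^ r) `^ r^-1)%R.
set b := ((x' `^ r + y' `^ r) `^ r^-1)%R.
have [/sum0 []// xE yE|a0] := eqVneq a 0%R.
  by rewrite xE yE !add0r lerDr powR_ge0.
have [/sum0 []// xE yE|b0] := eqVneq b 0%R.
  by rewrite xE yE !addr0 lerDl powR_ge0.
have {}a0 : (0 < a)%R by rewrite lt_neqAle eq_sym a0 powR_ge0.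
have {}b0 : (0 < b)%R by rewrite lt_neqAle eq_sym b0 powR_ge0.
have normK (u v : R) : (((u `^ r + v `^ r) `^ r^-1) `^ r = u `^ r + v `^ r)%R.
  by rewrite -powRrM mulVf ?gt_eqF // powRr1 // addr_ge0 // powR_ge0.
have aE : (a `^ r = x `^ r + y `^ r)%R := normK x y.
have bE : (b `^ r = x' `^ r + y' `^ r)%R := normK x' y'.
move: a b a0 b0 aE bE => a b a0 b0 aE bE.
have ab0 : (0 < a + b)%R by rewrite addr_gt0.
have -> : (a + b = ((a + b) `^ r) `^ r^-1)%R.
  by rewrite -powRrM mulfV ?gt_eqF // powRr1 // ltW.
apply: ge0_ler_powR; rewrite ?invr_ge0 ?(ltW r0) ?nnegrE ?addr_ge0 ?powR_ge0 //.
have H := lerD (powR_addr_convex r1 a0 b0 x0 x'0)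
  (powR_addr_convex r1 a0 b0 y0 y'0).
apply: (le_trans H) => {H}.
(* The weights a / (a + b) and b / (a + b) add up to 1. *)
rewrite -mulrDr -[leRHS]mulr1 ler_wpM2l ?powR_ge0 // addrACA -!mulrDr -!mulrDl.
by rewrite -aE -bE !divff ?gt_eqF ?powR_gt0 // !mulr1 -mulrDl divff // gt_eqF.
Qed.

Lemma pnorm_ge0 p u : 0 <= pnorm p u.
Proof.
case: p => [r||] //=; first exact: poweR_ge0.
by elim/big_ind: _ => // x y x0 y0; rewrite le_max x0.
Qed.

Section Fixed.
Variable p : \bar R.
Hypothesis p1 : 1 <= p.

Let r_gt0 r : p = r%:E -> (0 < r)%R.
Proof. by move=> pr; move: p1; rewrite pr lee_fin => /(lt_le_trans ltr01). Qed.

Lemma pnorm_nil : pnorm p [::] = 0.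
Proof.
case E : p => [r||] //=; last by rewrite big_nil.
by rewrite big_nil poweR0r // invr_eq0 gt_eqF // r_gt0.
Qed.

Lemma pnorm_seq1 x : 0 <= x -> pnorm p [:: x] = x.
Proof.
move=> x0; have := p1; case E : p => [r||] //= _; rewrite big_cons big_nil gee0_abs //.
  by rewrite adde0 -poweRrM mulfV ?gt_eqF ?r_gt0 // poweRe1.
by apply/max_idPl.
Qed.

Let p_cases : (exists2 r, p = r%:E & (1 <= r)%R) \/ p = +oo.
Proof. by move: p1; case: p => [r||] //; [left; exists r|right]. Qed.

Lemma pnorm_cat u v : pnorm p (u ++ v) = pnorm p [:: pnorm p u; pnorm p v].
Proof.
have abs_norm w : `|pnorm p w| = pnorm p w by rewrite gee0_abs ?pnorm_ge0.
case: p_cases => [[r pr r1]|poo].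
- have normE w : pnorm p w = (\sum_(x <- w) `|x| `^ r) `^ r^-1 by rewrite pr.
  have normK w : `|pnorm p w| `^ r = \sum_(x <- w) `|x| `^ r.
    rewrite abs_norm normE -poweRrM mulVf ?poweRe1 ?gt_eqF ?(r_gt0 pr) //.
    by apply: sume_ge0 => x _; exact: poweR_ge0.
  by rewrite [LHS]normE [RHS]normE big_cat !big_cons big_nil adde0 !normK.
- have normE w : pnorm p w = \big[maxe/0]_(x <- w) `|x| by rewrite poo.
  rewrite [LHS]normE [RHS]normE !big_cons big_nil !abs_norm.
  rewrite (max_idPl (pnorm_ge0 p v)) !normE.
  elim: u => [|x u IHu] /=; last by rewrite !big_cons IHu maxA.
  by rewrite big_nil -normE (max_idPr (pnorm_ge0 p v)).
Qed.

(** Reduces lists to pairs: the properties of the p-norm below are proved for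
    pairs and then transferred by induction. *)
Lemma pnorm_cons x u : 0 <= x -> pnorm p (x :: u) = pnorm p [:: x; pnorm p u].
Proof. by move=> x0; rewrite -cat1s pnorm_cat pnorm_seq1. Qed.

Lemma pnorm_pairC x y : pnorm p [:: x; y] = pnorm p [:: y; x].
Proof. by apply: pnormE_perm; rewrite (permEl (perm_catC [:: x] [:: y])). Qed.

Lemma pnorm_pair_mono x x' y y' : 0 <= x <= x' -> 0 <= y <= y' ->
  pnorm p [:: x; y] <= pnorm p [:: x'; y'].
Proof.
move=> /andP[x0 xx'] /andP[y0 yy'].
have x'0 := le_trans x0 xx'; have y'0 := le_trans y0 yy'.
case: p_cases => [[r -> r1]|->] /=; rewrite !big_cons !big_nil !gee0_abs //.
  have r0 : (0 <= r)%R := le_trans ler01 r1.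
  rewrite !adde0; apply: poweR_mono; rewrite ?invr_ge0 ?adde_ge0 ?poweR_ge0 //.
  by rewrite leeD // poweR_mono.
by rewrite (max_idPl y0) (max_idPl y'0) ge_max !le_max xx' yy' orbT.
Qed.

Lemma pnorm_pair_gel x y : 0 <= x -> 0 <= y -> x <= pnorm p [:: x; y].
Proof.
move=> x0 y0; rewrite -{1}(pnorm_seq1 x0) -(pnorm_cons0 p1) pnorm_pairC.
by apply: pnorm_pair_mono; rewrite ?lexx ?andbT //= x0.
Qed.

Lemma pnorm_pairD x x' y y' : 0 <= x -> 0 <= x' -> 0 <= y -> 0 <= y' ->
  pnorm p [:: x + x'; y + y'] <= pnorm p [:: x; y] + pnorm p [:: x'; y'].
Proof.
move=> x0 x'0 y0 y'0.
(* An infinite entry makes the right-hand side infinite, so only the case of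
   four real entries is left. *)
have infinite z w : 0 <= z -> 0 <= w -> z = +oo \/ w = +oo ->
    pnorm p [:: z; w] = +oo.
  move=> z0 w0 zw; apply/eqP; rewrite -leye_eq; case: zw => <-.
    exact: pnorm_pair_gel.
  by rewrite pnorm_pairC; exact: pnorm_pair_gel.
have [xy|xy] := pselect (x = +oo \/ y = +oo).
  rewrite (infinite x y) // addye ?leey //.
  by rewrite gt_eqF // (lt_le_trans _ (pnorm_ge0 _ _)).
have [xy'|xy'] := pselect (x' = +oo \/ y' = +oo).
  rewrite (infinite x' y') // addey ?leey //.
  by rewrite gt_eqF // (lt_le_trans _ (pnorm_ge0 _ _)).
move: xy xy' x0 x'0 y0 y'0 {infinite}.
case: x => [x|[]|//]; [|by left].
case: y => [y|[]|//]; [|by right].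
case: x' => [x'|_ []|//]; [|by left].
case: y' => [y'|_ []|//]; [|by right].
move=> _ _; rewrite !lee_fin => x0 x'0 y0 y'0.
case: p_cases => [[r -> r1]|->] /=;
  rewrite !big_cons !big_nil !gee0_abs ?adde_ge0 ?lee_fin //.
  by rewrite !addr0 powR_minkowski2.
have maxE (z w : R) : (0 <= w)%R -> maxe z%:E (maxe w%:E 0) = (Num.max z w)%:E.
  by move=> w0; rewrite EFin_max (@max_l _ _ w%:E) // lee_fin.
rewrite -!EFinD !maxE ?addr_ge0 // -EFinD lee_fin.
by rewrite ge_max; apply/andP; split; rewrite lerD // le_max lexx ?orbT.
Qed.

Lemma pnorm_map_mono (T : eqType) (f g : T -> \bar R) (s : seq T) :
  {in s, forall z, 0 <= f z <= g z} ->
  pnorm p [seq f z | z <- s] <= pnorm p [seq g z | z <- s].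
Proof.
elim: s => //= z s IHs fg; have /andP[f0 fgz] := fg z (mem_head _ _).
rewrite pnorm_cons // [leRHS]pnorm_cons ?(le_trans f0) //.
rewrite pnorm_pair_mono ?f0 // pnorm_ge0 IHs // => y ys.
by apply: fg; rewrite inE ys orbT.
Qed.

Lemma pnorm_mapD (T : eqType) (f g : T -> \bar R) (s : seq T) :
  {in s, forall z, 0 <= f z} -> {in s, forall z, 0 <= g z} ->
  pnorm p [seq f z + g z | z <- s] <=
    pnorm p [seq f z | z <- s] + pnorm p [seq g z | z <- s].
Proof.
elim: s => [|z s IHs] f0 g0; first by rewrite /= pnorm_nil adde0.
have fz := f0 z (mem_head _ _); have gz := g0 z (mem_head _ _).
have fs : {in s, forall y, 0 <= f y} by move=> y ys; apply: f0; rewrite inE ys orbT.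
have gs : {in s, forall y, 0 <= g y} by move=> y ys; apply: g0; rewrite inE ys orbT.
rewrite /= (pnorm_cons _ (adde_ge0 fz gz)) (pnorm_cons _ fz) (pnorm_cons _ gz).
have H := pnorm_pairD fz gz (pnorm_ge0 p (map f s)) (pnorm_ge0 p (map g s)).
apply: (le_trans _ H); apply: pnorm_pair_mono.
  by rewrite lexx andbT; exact: adde_ge0.
by rewrite pnorm_ge0; exact: IHs.
Qed.

(** The norm of a pair is 1-Lipschitz in its first entry: raising that entry by
    e raises the norm by at most the norm of (e, 0), which is e.  This gives the
    passage to the infimum for every p at once. *)
Lemma le_pnorm_infl c (S : set (\bar R)) y : (forall x, S x -> 0 <= x) -> 0 <= y ->
  (forall x, S x -> c <= pnorm p [:: x; y]) ->
  c <= pnorm p [:: ereal_inf S; y].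
Proof.
move=> S0 y0 cS; have inf0 : 0 <= ereal_inf S by exact: le_ereal_inf_tmp.
have [infE|infN] := eqVneq (ereal_inf S) +oo.
  apply: (@le_trans _ _ +oo); rewrite ?leey // -infE; exact: pnorm_pair_gel.
have inf_fin : ereal_inf S \is a fin_num by rewrite ge0_fin_numE // ltey.
apply/lee_addgt0Pr => e e0.
have [x Sx xe] := lb_ereal_inf_adherent e0 inf_fin.
apply: (le_trans (cS x Sx)).
apply: (@le_trans _ _ (pnorm p [:: ereal_inf S + e%:E; y + 0])).
  by apply: pnorm_pair_mono; [rewrite S0 // ltW|rewrite adde0 y0 lexx].
have e0' : 0 <= e%:E by rewrite lee_fin ltW.
apply: (le_trans (pnorm_pairD _ _ _ _)) => //.
by rewrite leeD2l // pnorm_pairC (pnorm_cons0 p1) pnorm_seq1.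
Qed.

Lemma le_pnorm_inf c (S T : set (\bar R)) :
  (forall x, S x -> 0 <= x) -> (forall y, T y -> 0 <= y) ->
  (forall x y, S x -> T y -> c <= pnorm p [:: x; y]) ->
  c <= pnorm p [:: ereal_inf S; ereal_inf T].
Proof.
move=> S0 T0 cST; apply: le_pnorm_infl => //; first exact: le_ereal_inf_tmp.
move=> x Sx; rewrite pnorm_pairC; apply: le_pnorm_infl => // [|y Ty]; first exact: S0.
by rewrite pnorm_pairC; exact: cST.
Qed.

End Fixed.

(** The sum of two numbers is the 1-norm of the pair. *)
Lemma le_ereal_infD c (S T : set (\bar R)) :
  (forall x, S x -> 0 <= x) -> (forall y, T y -> 0 <= y) ->
  (forall x y, S x -> T y -> c <= x + y) ->
  c <= ereal_inf S + ereal_inf T.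
Proof.
have pnorm1 x y : 0 <= x -> 0 <= y -> pnorm 1 [:: x; y] = x + y.
  move=> x0 y0; rewrite /= invr1 !big_cons big_nil adde0 !gee0_abs //.
  by rewrite !poweRe1 ?adde_ge0.
move=> S0 T0 cST; rewrite -pnorm1; try exact: le_ereal_inf_tmp.
apply: le_pnorm_inf => // x y Sx Ty; rewrite pnorm1; first exact: cST.
- exact: S0.
- exact: T0.
Qed.

End PNorm.

(** * Transport plans *)

Section Plans.
Context {X : choiceType}.
Set Implicit Arguments.
Unset Strict Implicit.
Implicit Types (A : set X) (s t : seq X) (l : seq (X * X)).

(** The combinatorics behind the composition of plans: the pairs of [q] join each
    entry of [s] to an entry of [t] with the same label. *)
Lemma perm_map_match (S T : eqType) (U : eqType) (f : S -> U) (g : T -> U)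
    (s : seq S) (t : seq T) :
  perm_eq (map f s) (map g t) ->
  exists q : seq (S * T), [/\ perm_eq (unzip1 q) s, perm_eq (unzip2 q) t &
    {in q, forall z, f z.1 = g z.2}].
Proof.
elim: s t => [|x s IHs] t fgst.
  by exists [::]; split=> //; case: t fgst => // y t /perm_size.
have /mapP[y yt fxgy] : f x \in map g t by rewrite -(perm_mem fgst) mem_head.
have yrem := perm_to_rem yt.
have /IHs[q [qs qt fg]] : perm_eq (map f s) (map g (rem y t)).
  rewrite -(perm_cons (f x)) {2}fxgy -map_cons -[_ :: map g _]/(map g (y :: rem y t)).
  by rewrite (permPl fgst); exact: perm_map.
exists ((x, y) :: q); split; rewrite /= ?perm_cons //.
  by rewrite (permPr yrem) perm_cons.
by move=> z /predU1P[->|/fg].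
Qed.

Lemma relsum_incl0 A x : A x -> relsum_incl A x = 0%R.
Proof.
move=> Ax; apply/relsumP; exists 0%R, (of_seq [:: x]); split.
- exact: supported0.
- by move=> y; rewrite (perm_mem (perm_of_seq _)) inE => /eqP ->.
- by rewrite addr0 add0r.
Qed.

Lemma sum_relsum_incl0 A s : {in s, forall x, A x} ->
  (\sum_(x <- s) relsum_incl A x = 0)%R.
Proof. by move=> As; rewrite big_seq big1 // => x /As; exact: relsum_incl0. Qed.

Lemma relsum_surj A (a : relsum A) :
  (\sum_(x <- terms (repr a)) relsum_incl A x)%R = a.
Proof. by rewrite sum_relsum_incl of_seq_terms reprK. Qed.

Lemma sum_relsum_incl_eq A s t :
  (\sum_(x <- s) relsum_incl A x = \sum_(x <- t) relsum_incl A x)%R ->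
  exists u v, [/\ {in u, forall x, A x}, {in v, forall x, A x} &
    perm_eq (s ++ u) (t ++ v)].
Proof.
rewrite !sum_relsum_incl => /relsumP[xi [eta [Axi Aeta E]]].
exists (terms xi), (terms eta); split=> //.
by apply/of_seqP; rewrite !of_seq_cat !of_seq_terms.
Qed.

(** A matching of [a] with [b] in which the terms added in A are implicit: they
    vanish in D(X, A). *)
Definition plan A (a b : relsum A) : set (seq (X * X)) :=
  [set l | (\sum_(z <- l) relsum_incl A z.1)%R = a /\
           (\sum_(z <- l) relsum_incl A z.2)%R = b].

Lemma plan_cat A (a b a' b' : relsum A) l l' :
  plan a b l -> plan a' b' l' -> plan (a + a')%R (b + b')%R (l ++ l').
Proof. by move=> [<- <-] [<- <-]; split; rewrite big_cat. Qed.

Lemma plan_swap A (a b : relsum A) l :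
  plan a b l -> plan b a [seq (z.2, z.1) | z <- l].
Proof. by move=> [<- <-]; split; rewrite big_map. Qed.

Section Cost.
Context {R : realType}.
Variables (p : \bar R) (d : X -> X -> \bar R) (A : set X).
Hypotheses (p1 : 1 <= p) (dA : is_metric_pair d A).

Definition plan_cost l : \bar R := pnorm p [seq d z.1 z.2 | z <- l].

Let dge0 x y : 0 <= d x y. Proof. by case: dA => -[]. Qed.
Let dxx x : d x x = 0. Proof. by case: dA => -[]. Qed.
Let dC x y : d x y = d y x. Proof. by case: dA => -[]. Qed.
Let dtri x y z : d x y <= d x z + d z y. Proof. by case: dA => -[]. Qed.

Lemma plan_diag_cost l s : plan_cost (l ++ [seq (x, x) | x <- s]) = plan_cost l.
Proof.
rewrite /plan_cost map_cat pnorm_cat0 // => c /mapP[z /mapP[x _ ->] ->].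
exact: dxx.
Qed.

(** Composition of plans.  The second components of [l] and the first components
    of [l'] both represent [c], hence agree up to terms in A.  Adding the pairs
    (x, x) for these terms leaves the costs unchanged and makes them equal as
    multisets, so that pairs (x, z) and (z, y) can be joined to (x, y). *)
Lemma plan_glue (a b c : relsum A) l l' : plan a c l -> plan c b l' ->
  exists2 l'', plan a b l'' & plan_cost l'' <= plan_cost l + plan_cost l'.
Proof.
move=> [<- lc] [l'c <-].
have [u [v [Au Av]]] : exists u v, [/\ {in u, forall x, A x},
    {in v, forall x, A x} & perm_eq (unzip2 l ++ u) (unzip1 l' ++ v)].
  by apply: sum_relsum_incl_eq; rewrite !big_map lc l'c.
pose m := l ++ [seq (x, x) | x <- u]; pose m' := l' ++ [seq (x, x) | x <- v].
have -> : unzip2 l ++ u = unzip2 m.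
  by rewrite /m /unzip2 map_cat -map_comp map_id.
have -> : unzip1 l' ++ v = unzip1 m'.
  by rewrite /m' /unzip1 map_cat -map_comp map_id.
move=> /perm_map_match[q [qm qm' glue]].
exists [seq (z.1.1, z.2.2) | z <- q].
  split; rewrite big_map.
    rewrite -(big_map fst xpredT (fun z => relsum_incl A z.1)) (perm_big _ qm) /=.
    by rewrite big_cat big_map /= (sum_relsum_incl0 Au) addr0.
  rewrite -(big_map snd xpredT (fun z => relsum_incl A z.2)) (perm_big _ qm') /=.
  by rewrite big_cat big_map /= (sum_relsum_incl0 Av) addr0.
rewrite -(plan_diag_cost l u) -(plan_diag_cost l' v) -/m -/m'.
have -> : plan_cost m = pnorm p [seq d z.1.1 z.1.2 | z <- q].
  rewrite [RHS](_ : _ = plan_cost (unzip1 q)); last by rewrite /plan_cost -map_comp.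
  by apply: pnormE_perm; apply: perm_map; rewrite perm_sym.
have -> : plan_cost m' = pnorm p [seq d z.2.1 z.2.2 | z <- q].
  rewrite [RHS](_ : _ = plan_cost (unzip2 q)); last by rewrite /plan_cost -map_comp.
  by apply: pnormE_perm; apply: perm_map; rewrite perm_sym.
have H := @pnorm_mapD _ _ p1 _ (fun z => d z.1.1 z.1.2) (fun z => d z.2.1 z.2.2) q.
apply: (le_trans _ (H _ _)) => //; rewrite /plan_cost -map_comp.
apply: pnorm_map_mono => // z zq; rewrite dge0 /= (glue z zq).
exact: dtri.
Qed.

(** The components of [l] are themselves sequences representing [a] and [b]; they
    are matched by the identity permutation, all the padding terms being one
    point a0 of A, so that the padding costs d a0 a0 = 0. *)
Lemma wasserstein_le_cost (a b : relsum A) l :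
  plan a b l -> wasserstein p d A a b <= plan_cost l.
Proof.
move=> [<- <-].
rewrite -(big_map fst xpredT (relsum_incl A)) -(big_map snd xpredT (relsum_incl A)).
rewrite wassersteinE // /wasserstein_seq; apply: ereal_inf_lbound.
have [a0 Aa0] : A !=set0 by case: dA.
have Anseq n x : x \in nseq n a0 -> A x by rewrite mem_nseq => /andP[_ /eqP ->].
set s := map fst l; set t := map snd l.
exists (nseq_tuple (size t) a0), (nseq_tuple (size s) a0), 1%g.
split; [exact: Anseq..|].
set S := cat_tuple _ _; set T := cat_tuple _ (nseq_tuple (size s) a0).
have -> : [seq d (tnth S k)
      (tnth T (cast_ord (addnC _ _) ((1%g : 'S_(size s + size t)) k)))
      | k : 'I_(size s + size t)] =
    [seq d z.1 z.2 | z <- zip (map (tnth S) (enum 'I_(size s + size t)))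
        (map (tnth (tcast (addnC _ _) T)) (enum 'I_(size s + size t)))].
  rewrite zip_map -map_comp; apply: eq_map => k /=.
  by rewrite tcastE perm1; congr (d _ (tnth _ _)); apply: val_inj.
rewrite !map_tnth_enum val_tcast /= zip_cat ?size_map // map_cat.
rewrite -/(unzip1 l) -/(unzip2 l) zip_unzip pnorm_cat0 // => c /mapP[z].
have -> : zip (nseq (size l) a0) (nseq (size l) a0) = nseq (size l) (a0, a0).
  by elim: (size l) => //= n ->.
by rewrite mem_nseq => /andP[_ /eqP ->] ->.
Qed.

(** A matching of the terms of [a] and [b] is read as the plan of its matched
    pairs. *)
Lemma wasserstein_ge (a b : relsum A) c :
  (forall l, plan a b l -> c <= plan_cost l) -> c <= wasserstein p d A a b.
Proof.
move=> cl; apply: le_ereal_inf_tmp => _ [u [v [sg [Au Av ->]]]].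
set S := cat_tuple _ u; set T := cat_tuple _ v.
set e := addnC _ _.
pose l := [seq (tnth S k, tnth T (cast_ord e (sg k)))
  | k <- enum 'I_(size (terms (repr a)) + size (terms (repr b)))].
have := cl l; rewrite /plan_cost -map_comp; apply.
split; rewrite big_map /= big_enum /=.
  rewrite -(big_tuple _ _ S xpredT (relsum_incl A)) big_cat /= relsum_surj.
  by rewrite sum_relsum_incl0 ?addr0.
have h_bij : bijective (fun k => cast_ord e (sg k)).
  exists (fun k => perm_inv sg (cast_ord (esym e) k)) => k.
    by rewrite cast_ordK permK.
  by rewrite permKV cast_ordKV.
rewrite -(@reindex _ _ _ _ _ _ xpredT (fun j => relsum_incl A (tnth T j))
  (onW_bij _ h_bij)).
rewrite -(big_tuple _ _ T xpredT (relsum_incl A)) big_cat /= relsum_surj.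
by rewrite sum_relsum_incl0 ?addr0.
Qed.

End Cost.
End Plans.

(** * The universal property *)

Section Universality.
Context {R : realType} {X : choiceType}.
Set Implicit Arguments.
Unset Strict Implicit.
Variables (p : \bar R) (d : X -> X -> \bar R) (A : set X).
Hypotheses (p1 : 1 <= p) (dA : is_metric_pair d A).

Local Notation W := (wasserstein p d A).
Local Notation incl := (relsum_incl A).

Let dge0 x y : 0 <= d x y. Proof. by case: dA => -[]. Qed.
Let dC x y : d x y = d y x. Proof. by case: dA => -[]. Qed.

Lemma wasserstein_inf (a b : relsum A) :
  W a b = ereal_inf [set plan_cost p d l | l in plan a b].
Proof.
apply/eqP; rewrite eq_le; apply/andP; split.
  by apply: le_ereal_inf_tmp => _ [l ab <-]; exact: wasserstein_le_cost.
by apply: wasserstein_ge => // l ab; apply: ereal_inf_lbound; exists l.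
Qed.

Let costs_ge0 (a b : relsum A) c :
  [set plan_cost p d l | l in plan a b] c -> 0 <= c.
Proof. by move=> [l _ <-]; exact: pnorm_ge0. Qed.

Lemma wasserstein_metric : is_metric W.
Proof.
have le_swap (a b : relsum A) : W a b <= W b a.
  rewrite [leRHS]wasserstein_inf; apply: le_ereal_inf_tmp => _ [l ab <-].
  apply: (le_trans (wasserstein_le_cost p1 dA (plan_swap ab))).
  by rewrite /plan_cost -map_comp (eq_map (g := fun z => d z.1 z.2)) //.
split.
- move=> a b; rewrite wasserstein_inf; apply: le_ereal_inf_tmp; exact: costs_ge0.
- move=> a; apply/eqP; rewrite eq_le; apply/andP; split; last first.
    by rewrite wasserstein_inf; apply: le_ereal_inf_tmp; exact: costs_ge0.
  have aa : plan a a [seq (x, x) | x <- terms (repr a)].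
    by split; rewrite big_map relsum_surj.
  apply: (le_trans (wasserstein_le_cost p1 dA aa)).
  by rewrite (plan_diag_cost p1 dA [::]) /plan_cost pnorm_nil.
- by move=> a b; apply/eqP; rewrite eq_le !le_swap.
- move=> a b c; rewrite [W a c]wasserstein_inf [W c b]wasserstein_inf.
  apply: le_ereal_infD; [exact: costs_ge0..|].
  move=> _ _ [l ac <-] [l' cb <-].
  have [l'' ab le_cost] := plan_glue p1 dA ac cb.
  exact: le_trans (wasserstein_le_cost p1 dA ab) le_cost.
Qed.

Lemma wasserstein_subadditive : p_subadditive p W.
Proof.
move=> a b a' b'; rewrite [W a a']wasserstein_inf [W b b']wasserstein_inf.
apply: le_pnorm_inf => //; [exact: costs_ge0..|].
move=> _ _ [l aa' <-] [l' bb' <-].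
apply: (le_trans (wasserstein_le_cost p1 dA (plan_cat aa' bb'))).
by rewrite /plan_cost map_cat pnorm_cat.
Qed.

Lemma wasserstein_incl_le x y : W (incl x) (incl y) <= dist_p p d A x y.
Proof.
have pair_plan : plan (incl x) (incl y) [:: (x, y)].
  by split; rewrite big_seq1.
rewrite le_min; apply/andP; split.
  apply: (le_trans (wasserstein_le_cost p1 dA pair_plan)).
  by rewrite /plan_cost /= pnorm_seq1.
apply: le_pnorm_inf => //; [by move=> _ [a _ <-]..|].
move=> _ _ [a Aa <-] [a' Aa' <-].
have axy : plan (incl x) (incl y) [:: (x, a); (a', y)].
  by split; rewrite big_cons big_seq1 /= ?(relsum_incl0 Aa) ?(relsum_incl0 Aa');
    rewrite ?addr0 ?add0r.
by apply: (le_trans (wasserstein_le_cost p1 dA axy)); rewrite /plan_cost /= (dC a').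
Qed.

(** A permutation of two indices either keeps x with y, or sends x to a point of A
    and a point of A to y. *)
Lemma dist_p_le_wasserstein x y : dist_p p d A x y <= W (incl x) (incl y).
Proof.
have inclE z : incl z = (\sum_(w <- [:: z]) incl w)%R by rewrite big_seq1.
rewrite (inclE x) (inclE y) wassersteinE //.
apply: le_ereal_inf_tmp => _ [a [a' [sg [Aa Aa' ->]]]].
case: a Aa => [[|a [|//]] // sz] Aa; case: a' Aa' => [[|a' [|//]] // sz'] Aa'.
have {}Aa : A a by apply: Aa; rewrite mem_head.
have {}Aa' : A a' by apply: Aa'; rewrite mem_head.
rewrite /= in sg *.
rewrite /image_mem enum_ordSl enum_ordSl (size0nil (size_enum_ord 0)) /=.
rewrite !(tnth_nth x) /=.
have [i0 i1] : (sg ord0 < 2)%N /\ (sg (lift ord0 ord0) < 2)%N by [].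
have : (sg ord0 : nat) != sg (lift ord0 ord0).
  by rewrite (inj_eq val_inj) (inj_eq perm_inj).
case: (nat_of_ord (sg ord0)) i0 => [|[|//]] _;
  case: (nat_of_ord (sg (lift ord0 ord0))) i1 => [|[|//]] _ //= _.
- rewrite ge_min; apply/orP; left; exact: pnorm_pair_gel.
- rewrite ge_min; apply/orP; right; apply: pnorm_pair_mono => //.
  + rewrite le_ereal_inf_tmp /=; last by move=> _ [? _ <-].
    by apply: ereal_inf_lbound; exists a'.
  + rewrite le_ereal_inf_tmp /=; last by move=> _ [? _ <-].
    by rewrite dC; apply: ereal_inf_lbound; exists a.
Qed.

Lemma subadditive_sum_le (M : nmodType) (rho : M -> M -> \bar R) (T : eqType)
    (f g : T -> M) (s : seq T) :
  is_metric rho -> p_subadditive p rho ->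
  rho (\sum_(z <- s) f z)%R (\sum_(z <- s) g z)%R <=
    pnorm p [seq rho (f z) (g z) | z <- s].
Proof.
move=> [rho0 rhoxx _ _] sub; elim: s => [|z s IHs].
  by rewrite !big_nil rhoxx pnorm_ge0.
rewrite !big_cons /= pnorm_cons //; apply: (le_trans (sub _ _ _ _)).
by apply: pnorm_pair_mono; rewrite // ?rho0 ?IHs ?lexx.
Qed.

Lemma wasserstein_largest (rho : relsum A -> relsum A -> \bar R) :
  is_metric rho -> p_subadditive p rho ->
  (forall x y, rho (incl x) (incl y) <= d x y) ->
  forall a b, rho a b <= W a b.
Proof.
move=> mrho sub rhod a b; apply: wasserstein_ge => // l [<- <-].
apply: (le_trans (subadditive_sum_le _ _ _ mrho sub)).
have [rho0 _ _ _] := mrho.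
by apply: pnorm_map_mono => // z _; rewrite rho0 rhod.
Qed.

End Universality.

Theorem corollary1p4 (R : realType) (X : choiceType) (p : \bar R)
    (d : X -> X -> \bar R) (A : set X) (p1 : 1 <= p) (dA : is_metric_pair d A) :
  [/\ is_metric (wasserstein p d A),
      p_subadditive p (wasserstein p d A),
      pullback (relsum_incl A) (wasserstein p d A) = dist_p p d A &
      forall rho : relsum A -> relsum A -> \bar R,
        is_metric rho -> p_subadditive p rho ->
        pullback (relsum_incl A) rho = dist_p p d A ->
        forall a b : relsum A, rho a b <= wasserstein p d A a b].
Proof.
split.
- exact: wasserstein_metric.
- exact: wasserstein_subadditive.
- apply/funext => x; apply/funext => y; apply/eqP; rewrite eq_le.
  by rewrite wasserstein_incl_le // dist_p_le_wasserstein.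
- move=> rho mrho sub rhoE; apply: wasserstein_largest => // x y.
  by rewrite -[rho _ _]/(pullback _ rho x y) rhoE /dist_p ge_min lexx.
Qed.
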